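(* For arbitrary positive integers $r\ge \ell$ and $k$ we have $$R_{\mathrm{list}}\bigl(K_r^{(\ell)},k\bigr)\le 2^{4r^{3\ell-1}+4kr^{\ell-1}\log_2 r}.$$
   Context: $K_n^{(\ell)}$ is the complete $\ell$-uniform hypergraph on $n$ vertices (its edges are all $\ell$-element subsets of the vertex set). Given an assignment $L$ of a set $L_e\subseteq\mathbb{N}$ to each edge $e$ of $K_n^{(\ell)}$, an $L$-colouring is a function $c:E(K_n^{(\ell)})\to\mathbb{N}$ with $c(e)\in L_e$ for all $e$. For an $\ell$-uniform hypergraph $H$ and a positive integer $k$, the list Ramsey number $R_{\mathrm{list}}(H,k)$ is the smallest $n$ for which there exists an assignment $L$ of lists with $|L_e|=k$ for every $e\in E(K_n^{(\ell)})$ such that every $L$-colouring of $E(K_n^{(\ell)})$ contains a monochromatic copy of $H$ (a not necessarily induced subhypergraph isomorphic to $H$ all of whose edges have the same colour). *)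

(* Defs.v *)
From HB Require Import structures.
From mathcomp Require Import all_boot all_order all_algebra finmap.
From mathcomp Require Import all_classical all_reals all_analysis.

Set Implicit Arguments.
Unset Strict Implicit.
Unset Printing Implicit Defensive.

Import Order.TTheory GRing.Theory Num.Theory.

Record uhypergraph (l : nat) := UHypergraph {
  vertex : finType;
  edges : {set {set vertex}};
  edges_uniform : forall e, e \in edges -> #|e| = l
}.

Definition complete_edges (n l : nat) : {set {set 'I_n}} :=
  [set e : {set 'I_n} | #|e| == l].

Lemma complete_edges_uniform n l (e : {set 'I_n}) :
  e \in complete_edges n l -> #|e| = l.
Proof. by rewrite inE => /eqP. Qed.

(* K_n^(l) *)
Definition complete_uhypergraph (n l : nat) : uhypergraph l :=
  UHypergraph (@complete_edges_uniform n l).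

(* [F] is the edge set of a (not necessarily induced) subhypergraph of [G]
   isomorphic to [H]; the isomorphism is the embedding [f], and the vertex set
   of the copy is the image of [f]. *)
Definition is_copy l (H G : uhypergraph l) (F : {set {set vertex G}}) : Prop :=
  F \subset edges G /\
  exists f : vertex H -> vertex G,
    injective f /\ F = [set f @: e | e : {set vertex H} in edges H].

(* Lists and colourings are functions on all sets of vertices, but only their
   values on the edges are ever constrained or used. *)
Definition is_list_colouring l (G : uhypergraph l)
    (L : {set vertex G} -> {fset nat}) (c : {set vertex G} -> nat) : Prop :=
  forall e, e \in edges G -> c e \in L e.

Definition has_monochromatic_copy l (H G : uhypergraph l)
    (c : {set vertex G} -> nat) : Prop :=
  exists F : {set {set vertex G}},
    is_copy H F /\ exists a : nat, forall e, e \in F -> c e = a.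

Definition list_ramsey_property l (H : uhypergraph l) (k n : nat) : Prop :=
  let K := complete_uhypergraph n l in
  exists L : {set vertex K} -> {fset nat},
    (forall e, e \in edges K -> #|` L e | = k) /\
    (forall c : {set vertex K} -> nat,
       is_list_colouring L c -> has_monochromatic_copy H c).

(* N = R_list(H, k) *)
Definition is_list_ramsey_number l (H : uhypergraph l) (k N : nat) : Prop :=
  list_ramsey_property H k N /\
  forall n, list_ramsey_property H k n -> (N <= n)%N.

Definition log2 (R : realType) (x : R) : R := (ln x / ln 2)%R.

(* Main.v *)
Require Import Defs.
From mathcomp Require Import all_boot all_order all_algebra finmap.
From mathcomp Require Import all_classical all_reals all_analysis.
From mathcomp Require Import zify ring lra.
From mathcomp Require Import fintype finset.

(** Let n be the number of vertices, N = 'C(n, l) the number of edges and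
    s = 'C(r, l) the number of edges of a copy of the clique on r vertices.
    Draw the list of every edge uniformly among the k-subsets of a palette of
    m = 8 * s * k colours. If the lists admit a colouring without monochromatic
    clique, then every colour class is a set of edges containing no clique, and
    every edge lies in the class of a colour of its list. There are far too
    many clique-free sets of edges for a union bound over the classes
    themselves; the hypergraph container method replaces each class by one of
    few larger sets. Here a container is represented by its complement: a
    family F of sets of edges, each of size at least N / (2 * s), such that
    every clique-free set is disjoint from some member of F
    (clique_free_cocontainers).

    For a fixed choice of a member D i of F for each colour i, an edge v is
    missed by the colours i with v in D i. Averaging gives at least N / (4 * s)
    edges that are missed by at least m / (4 * s) colours, and the random list
    of such an edge consists of missed colours only with probability at least
    (8 * s) ^ - k. No colouring compatible with the D i exists as soon as this
    happens for one edge. It fails for all edges with probability at most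
    (1 - (8 * s) ^ - k) ^ (N / (4 * s)). When log2 (size F) is small compared
    with N / (8 * s) ^ k, this is less than the inverse of the number of choices
    of the D i (lists_defeating_family).

    The family F comes from the s-uniform hypergraph whose vertices are the
    edges of the complete hypergraph and whose hyperedges are the cliques. One
    round of the container algorithm turns a j-uniform weight without
    concentrated codegrees into a (j - 1)-uniform one by adding up links of
    vertices of the independent set: either the set avoids all vertices of
    large degree, which form a large member of F, or one of them is a branching
    choice among N. About p * N choices suffice for one uniformity, where p
    measures the sparsity of the links (stage_cocontainers), so that
    uniform_cocontainers records an independent set by about s * p * N choices.
    Its members are only a 2 ^ - O(s ^ 2) fraction of the edges; repeating the
    algorithm outside the members already found brings them to N / (2 * s)
    (copy_free_cocontainers): a smaller set of edges meets at most half of the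
    cliques, so the hypotheses persist up to a factor 2 outside it.

    For cliques the codegree hypothesis holds with p ^ 'C(r.-1, l.-1) = r / n,
    because a set of i edges spanning l + e vertices satisfies
    i - 1 <= e * 'C(r.-1, l.-1) and is contained in a proportion at most
    (s / N) * (r / n) ^ e of the cliques. The union bound asks for a value of
    1 / p of the order of 2 ^ O(s ^ 2) * (8 * s) ^ k up to factors polynomial
    in r ^ l and k; the choice 1 / p = 2 ^ (3 * r ^ (2 * l)) * r ^ ((l + 2) * k),
    named sparsity, gives room when 2 <= l, and n = r * (1 / p) ^ 'C(r.-1, l.-1)
    lies below the claimed bound. For l = 1 a copy is just a set of r vertices of one
    colour, and identical lists with the pigeonhole principle suffice. *)

Set Implicit Arguments.
Unset Strict Implicit.
Unset Printing Implicit Defensive.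

Import Order.TTheory GRing.Theory Num.Theory.

(** * Weighted hypergraphs *)

Lemma leq_card_bigcup (I T : finType) (P : pred I) (A : I -> {set T}) :
  (#|\bigcup_(i | P i) A i| <= \sum_(i | P i) #|A i|)%N.
Proof.
elim/big_rec2: _ => [|i m B _ IH]; first by rewrite cards0.
by rewrite (leq_trans (leq_card_setU _ _)) // leq_add2l.
Qed.

Section Weights.
Local Open Scope ring_scope.
Variables (R : realFieldType) (V : finType).
Implicit Types (w Q : {set V} -> R) (S T I D : {set V}) (p theta : R).

Definition deg w T : R := \sum_(S : {set V} | T \subset S) w S.
(** The total weight, written as a degree so that the lemmas on degrees apply. *)
Definition weight w : R := deg w set0.
Definition uniform j w := forall S, w S != 0 -> #|S| = j.
Definition independent w I := forall S, S \subset I -> w S = 0.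
Definition link w v S : R := if v \in S then 0 else w (v |: S).
(** The codegree condition of the container method: up to the factor [theta],
    a set of i points has codegree at most p ^ (i - 1), the decay that weights
    keep when each link costs a factor [p]. *)
Definition spread p theta w :=
  forall T, T != set0 -> deg w T <= theta * p ^+ #|T|.-1.

(** The members of [F] are complements of containers: a set that avoids [D] is
    contained in ~: D. *)
Definition has_cocontainers (P : {set V} -> Prop) (M : nat) (x : R) : Prop :=
  exists F : seq {set V},
    [/\ (size F <= M)%N,
        forall D, D \in F -> x <= #|D|%:R
      & forall I, P I -> exists2 D, D \in F & [disjoint D & I]].

Lemma weightE w : weight w = \sum_S w S.
Proof. by apply: eq_bigl => S; rewrite sub0set. Qed.

Lemma deg_ge0 w T : (forall S, 0 <= w S) -> 0 <= deg w T.
Proof. by move=> w0; apply: sumr_ge0. Qed.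

Lemma degD w Q T : deg (fun S => w S + Q S) T = deg w T + deg Q T.
Proof. exact: big_split. Qed.

Lemma degZ c w T : deg (fun S => c * w S) T = c * deg w T.
Proof. by rewrite /deg mulr_sumr. Qed.

Lemma ler_deg w Q T : (forall S, w S <= Q S) -> deg w T <= deg Q T.
Proof. by move=> le_wQ; apply: ler_sum. Qed.

Lemma sum_deg1 j w : uniform j w -> \sum_v deg w [set v] = j%:R * weight w.
Proof.
move=> uw; rewrite weightE mulr_sumr /deg (exchange_big_dep predT) //=.
apply: eq_bigr => S _.
have [->|wS] := eqVneq (w S) 0; first by rewrite mulr0 big1.
rewrite (eq_bigl (mem S)) => [|v]; last by rewrite sub1set.
by rewrite sumr_const (uw _ wS) mulr_natl.
Qed.

Lemma sum_deg_all j w : uniform j w -> \sum_T deg w T = 2 ^+ j * weight w.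
Proof.
move=> uw; rewrite weightE mulr_sumr /deg (exchange_big_dep predT) //=.
apply: eq_bigr => S _.
have [->|wS] := eqVneq (w S) 0; first by rewrite mulr0 big1.
rewrite sumr_const -(uw _ wS) -natrX mulr_natl; congr (_ *+ _).
by rewrite -card_powerset; apply: eq_card => T; rewrite !inE.
Qed.

Lemma deg_link w v T :
  deg (link w v) T = if v \in T then 0 else deg w (v |: T).
Proof.
rewrite /deg; case: ifPn => vT.
  by rewrite big1 // => S /subsetP/(_ v vT) vS; rewrite /link vS.
rewrite [RHS](reindex_onto (fun S => v |: S) (fun S => S :\ v)) /=; last first.
  by move=> S; rewrite subUset sub1set => /andP[vS _]; rewrite setD1K.
rewrite [LHS]big_mkcond [RHS]big_mkcond; apply: eq_bigr => S _; rewrite /link.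
have [vS|vS] := boolP (v \in S).
  rewrite (_ : (_ :\ v == S) = false) ?andbF ?if_same //.
  by apply/eqP => eS; move: vS; rewrite -eS setD11.
rewrite setU1K // eqxx andbT; congr (if _ then _ else _).
rewrite subUset sub1set setU11 /=; apply/idP/idP => [|/subsetP sTS].
  by move=> /subset_trans; apply; exact: subsetUr.
apply/subsetP => u uT; have /setU1P[uv|//] := sTS u uT.
by rewrite -uv uT in vT.
Qed.

End Weights.

(** * One round of the container algorithm *)

Section Containers.
Local Open Scope ring_scope.
Variables (R : realFieldType) (V : finType).
Implicit Types (w Q : {set V} -> R) (S T I D X : {set V}) (p theta x : R).

(** A single query of the algorithm: either the unknown set avoids [X], which
    may then be output, or one of its points in [X] is revealed. *)
Lemma cocontainers_branch (P : {set V} -> Prop) (M : nat) x X :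
    (0 < M)%N -> x <= #|X|%:R ->
    (forall v, v \in X -> has_cocontainers (fun I => P I /\ v \in I) M x) ->
  has_cocontainers P (#|V|.+1 * M) x.
Proof.
move=> M0 leX br.
have /fin_all_exists[F HF] v : exists F : seq {set V},
    [/\ (size F <= M)%N, forall D, D \in F -> x <= #|D|%:R
      & v \in X -> forall I, P I /\ v \in I ->
          exists2 D, D \in F & [disjoint D & I]].
  have [/br[F [sF cF bF]]|_] := boolP (v \in X); first by exists F.
  by exists [::].
exists (X :: flatten [seq F v | v <- enum V]); split.
- rewrite /= mulSn; apply: leq_ltn_trans (_ : #|V| * M < _)%N; last first.
    by rewrite -[ltnLHS]add0n ltn_add2r.
  rewrite cardE size_flatten /shape -map_comp.
  elim: (enum V) => //= v s IHs; rewrite mulSn leq_add //.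
  by have [] := HF v.
- move=> D; rewrite inE => /predU1P[-> //|/flatten_mapP[v _ DF]].
  by have [_ + _] := HF v; apply.
- move=> I PI; have [dXI|] := boolP [disjoint X & I].
    by exists X; rewrite ?mem_head.
  rewrite -setI_eq0 => /set0Pn[v /setIP[vX vI]].
  have [_ _ /(_ vX I (conj PI vI))[D DF dD]] := HF v.
  exists D => //; rewrite inE; apply/orP; right; apply/flatten_mapP.
  by exists v; rewrite ?mem_enum.
Qed.

Lemma has_cocontainersW (P P' : {set V} -> Prop) (M M' : nat) x :
    (forall I, P' I -> P I) -> (M <= M')%N ->
  has_cocontainers P M x -> has_cocontainers P' M' x.
Proof.
move=> PP' leM [F [sF cF bF]]; exists F; split=> //; first exact: leq_trans leM.
by move=> I /PP'; apply: bF.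
Qed.

Section Stage.
Variables (j : nat) (w : {set V} -> R) (p theta : R).
Hypotheses (w_ge0 : forall S, 0 <= w S) (w_unif : uniform j.+1 w).
Hypotheses (w_ge1 : 1 <= weight w) (w_spread : spread p theta w).
Hypotheses (p_gt0 : 0 < p) (theta_gt0 : 0 < theta).

(** A stage accumulates in [Q] a j-uniform weight, a sum of links of points of
    the unknown independent set. As soon as the codegree of [T] reaches its
    cap, the part of [w] above [T] is withdrawn from further links. *)
Definition saturated Q T := (T != set0) && (theta * p ^+ #|T| <= deg Q T).

Definition avail Q S : R :=
  if [exists T : {set V}, (T \subset S) && saturated Q T] then 0 else w S.

Definition extend Q v S : R := Q S + link (avail Q) v S.

(** The factor 2 leaves room for the last link added before [T] saturates. *)
Definition stage_state Q :=
  [/\ forall S, 0 <= Q S, uniform j Q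
    & forall T, T != set0 -> deg Q T <= 2 * theta * p ^+ #|T|].

Lemma avail_ge0 Q S : 0 <= avail Q S.
Proof. by rewrite /avail; case: ifP. Qed.

Lemma avail_le Q S : avail Q S <= w S.
Proof. by rewrite /avail; case: ifP. Qed.

Lemma avail_uniform Q : uniform j.+1 (avail Q).
Proof. by move=> S; rewrite /avail; case: ifP => _; [rewrite eqxx|exact: w_unif]. Qed.

(** Withdrawals are charged to [Q]: a saturated set [T] withdraws at most
    theta * p ^ (#|T| - 1), which is at most 1 / p times its codegree in [Q],
    and each set in the support of [Q] is charged by at most its 2 ^ j subsets.
    So the withdrawn weight stays small as long as [Q] is light. *)
Lemma weight_avail Q : stage_state Q ->
  p * (weight w - weight (avail Q)) <= 2 ^+ j * weight Q.
Proof.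
move=> [Q0 Qu _]; rewrite -(sum_deg_all Qu) !weightE -sumrB.
apply: le_trans (_ : \sum_(T | saturated Q T) p * deg w T <= _); last first.
  rewrite big_mkcond; apply: ler_sum => T _; case: ifP => [|_]; last exact: deg_ge0.
  move=> /andP[T0 satT]; apply: le_trans satT.
  rewrite -(prednK (_ : 0 < #|T|)%N) ?card_gt0 // exprS mulrCA.
  by rewrite ler_pM2l // w_spread.
rewrite -mulr_sumr ler_pM2l // /deg (exchange_big_dep predT) //=.
apply: ler_sum => S _; rewrite /avail; case: ifPn => [/existsP[T /andP[TS sT]]|_].
  by rewrite subr0 (bigD1 T) ?sT //= lerDl sumr_ge0.
by rewrite subrr sumr_ge0.
Qed.

Definition popular Q := [set v | (4 * #|V|%:R)^-1 <= deg (avail Q) [set v]].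

(** The degrees sum to at least 1 / 2; unpopular points contribute at most 1 / 4
    in total, and a single point contributes at most [theta]. *)
Lemma card_popular Q : 2^-1 <= weight (avail Q) ->
  (4 * theta)^-1 <= #|popular Q|%:R :> R.
Proof.
move=> wA; have := sum_deg1 (@avail_uniform Q) => sumE.
have le1 : 2^-1 <= \sum_v deg (avail Q) [set v].
  rewrite sumE; apply: (le_trans wA); rewrite ler_peMl ?ler1n //.
  by apply: le_trans wA; rewrite invr_ge0.
have le2 : \sum_v deg (avail Q) [set v] <= \sum_(v in popular Q) theta
    + \sum_(v : V) (4 * #|V|%:R)^-1.
  rewrite (bigID (mem (popular Q))) /= lerD //.
    apply: ler_sum => v _; apply: le_trans (ler_deg _ (avail_le Q)) _.
    apply: le_trans (w_spread _) _; first by rewrite -card_gt0 cards1.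
    by rewrite cards1 mulr1.
  rewrite big_mkcond /=; apply: ler_sum => v _; rewrite inE -ltNge.
  by case: ifP => [/ltW //|_]; rewrite invr_ge0 mulr_ge0.
have le3 : \sum_(v : V) (4 * #|V|%:R)^-1 <= 4^-1 :> R.
  rewrite sumr_const -[_ *+ _]mulr_natl; case: (posnP #|V|) => [->|V0].
    by rewrite mul0r invr_ge0.
  by rewrite invfM mulrCA divff ?mulr1 // pnatr_eq0 -lt0n.
rewrite sumr_const -[_ *+ _]mulr_natl in le2.
have : 4^-1 <= #|popular Q|%:R * theta by lra.
by rewrite invfM ler_pdivrMr.
Qed.

(** An unsaturated [T] is below its cap and one link adds at most another cap,
    by the codegree condition on v |: T; a saturated [T] receives nothing. *)
Lemma extend_state Q v : stage_state Q -> stage_state (extend Q v).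
Proof.
move=> [Q0 Qu Qd]; split=> [S|S|T T0].
- by rewrite addr_ge0 // /link; case: ifP => // _; exact: avail_ge0.
- rewrite /extend /link; have [vS|vS] := boolP (v \in S); first by rewrite addr0; exact: Qu.
  have [->|] := eqVneq (Q S) 0; last by move=> /Qu.
  by rewrite add0r => /avail_uniform; rewrite cardsU1 vS => -[].
rewrite degD deg_link; have [vT|vT] := boolP (v \in T); first by rewrite addr0 Qd.
have [sT|nsT] := boolP (saturated Q T).
  rewrite [deg (avail Q) _]big1 ?addr0 ?Qd // => S.
  rewrite subUset => /andP[_ TS]; rewrite /avail ifT //.
  by apply/existsP; exists T; rewrite TS.
rewrite -mulrA mulr_natl mulr2n lerD //.
  by move: nsT; rewrite /saturated T0 /= -ltNge => /ltW.
apply: le_trans (ler_deg _ (avail_le Q)) _.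
apply: le_trans (w_spread _) _; last by rewrite cardsU1 vT.
by rewrite -card_gt0 cardsU1 vT.
Qed.

(** Every popular point of the independent set that is revealed adds at least
    1 / (4 * #|V|) to the weight of [Q], so [t] queries are enough to bring it
    from its current value to [eta], unless a query outputs a large set of
    popular points. The bound on [eta] keeps at least half of [w] available
    until then. *)
Lemma stage_cocontainers (eta x : R) (M : nat) :
    2 ^+ j.+1 * eta <= p -> (0 < M)%N -> x <= (4 * theta)^-1 ->
    (forall Q, stage_state Q -> eta <= weight Q ->
      has_cocontainers (independent Q) M x) ->
  forall t Q, stage_state Q -> eta <= weight Q + t%:R / (4 * #|V|%:R) ->
    has_cocontainers (fun I => independent w I /\ independent Q I) (#|V|.+1 ^ t * M) x.
Proof.
move=> le_eta M0 lex fin; elim=> [|t IHt] Q stQ.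
  rewrite mul0r addr0 => /(fin Q stQ); apply: has_cocontainersW => [I []//|].
  by rewrite mul1n.
move=> le_t; have [/(fin Q stQ)|ltQ] := leP eta (weight Q).
  apply: has_cocontainersW => [I []//|]; by rewrite leq_pmull // expn_gt0.
rewrite expnS -mulnA.
apply: (@cocontainers_branch _ _ _ (popular Q)) => [||v].
  by rewrite muln_gt0 expn_gt0.
  apply: le_trans lex _; apply: card_popular.
  have := weight_avail stQ.
  have : 2 ^+ j * weight Q < p * 2^-1.
    apply: lt_le_trans (_ : 2 ^+ j * eta <= _); first by rewrite ltr_pM2l ?exprn_gt0.
    by move: le_eta; rewrite exprS -mulrA; rewrite ler_pdivlMr // mulrC.
  move=> /[swap] /le_lt_trans /[apply]; rewrite ltr_pM2l // => hA; move: w_ge1 hA; lra.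
rewrite inE => popv.
apply: (has_cocontainersW _ (leqnn _)) (IHt (extend Q v) _ _) => [I [[iw iQ] vI]||].
- split=> // S SI; rewrite /extend (iQ S SI) add0r /link.
  case: ifP => // _; rewrite /avail; case: ifP => // _; apply: iw.
  by rewrite subUset sub1set vI.
- exact: extend_state.
apply: le_trans le_t _.
rewrite /weight degD deg_link inE setU0 -[t.+1]add1n natrD mulrDl mul1r.
by rewrite -/(weight Q) -addrA lerD2l lerD2r.
Qed.

End Stage.

(** The factor 2 ^ (i + 2) lost between uniformities i + 1 and i has a part
    2 ^ (i + 1), by which the links accumulated in a stage fall short of weight
    [p], and a part 2 from the bound on codegrees in [stage_state]. *)
Fixpoint container_loss (j : nat) : nat := if j is i.+1 then
  if i is 0 then 1 else 2 ^ i.+2 * container_loss i else 1.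

Lemma container_loss_gt0 j : (0 < container_loss j)%N.
Proof. by elim: j => [|[|j] IHj] //; rewrite /= muln_gt0 expn_gt0. Qed.

Lemma container_lossS j : container_loss j.+2 = (2 ^ j.+3 * container_loss j.+1)%N.
Proof. by []. Qed.

(** Induction on the uniformity: a stage replaces a (j + 2)-uniform weight by a
    (j + 1)-uniform one, rescaled to total weight at least 1 at the price of a
    larger [theta]. For a 1-uniform weight the support is itself disjoint from
    every independent set, and it is large because no point is heavy. *)
Lemma uniform_cocontainers (b j : nat) w p theta :
    0 < p -> p * #|V|%:R <= b%:R -> 0 < theta ->
    (forall S, 0 <= w S) -> uniform j.+1 w -> 1 <= weight w ->
    spread p theta w ->
  has_cocontainers (independent w) (#|V|.+1 ^ (b * j))
    (theta * (container_loss j.+1)%:R)^-1.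
Proof.
move=> p0 leb; elim: j => [|j IHj] in w theta * => t0 w0 wu w1 ws.
  rewrite muln0 mulr1; exists [:: [set v | w [set v] != 0]]; split=> // [D|I iI].
    rewrite inE => /eqP->; rewrite -[theta^-1]mul1r ler_pdivrMr //.
    apply: le_trans w1 _; rewrite -[leLHS]mul1r -(sum_deg1 wu) mulr_natl -sumr_const.
    rewrite [leRHS]big_mkcond; apply: ler_sum => v _; rewrite inE; case: eqP => [wv|_] /=.
      rewrite /deg big1 // => S; rewrite sub1set => vS.
      apply/eqP/negPn/negP => wS; case/negP: (wS).
      have /eqP/cards1P[u eS] := wu S wS.
      by move: vS; rewrite eS inE => /eqP <-; rewrite wv.
    by apply: le_trans (ws _ _) _; rewrite ?cards1 ?mulr1 // -card_gt0 cards1.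
  exists [set v | w [set v] != 0]; first exact: mem_head.
  rewrite disjoint_subset; apply/subsetP => v; rewrite !inE => wv.
  by apply/negP => vI; move: wv; rewrite iI ?sub1set ?eqxx.
have V0 : 0 < #|V|%:R :> R.
  rewrite ltr0n lt0n; apply/eqP => /card0_eq V0; have := sum_deg1 wu.
  rewrite big1 => [/esym/eqP|v]; last by have := V0 v.
  by rewrite mulf_eq0 pnatr_eq0 /= => /eqP w_0; rewrite w_0 ler10 in w1.
(* Up to this weight, withdrawals take away at most half of w. *)
pose eta := p / 2 ^+ j.+2.
have eta0 : 0 < eta by rewrite divr_gt0 ?exprn_gt0.
have st0 : stage_state j.+1 p theta (fun=> 0).
  split=> // [S|T _]; first by rewrite eqxx.
  by rewrite /deg big1 // mulr_ge0 ?exprn_ge0 ?mulr_ge0 // ltW.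
rewrite mulnS expnD.
apply: has_cocontainersW
  (stage_cocontainers w0 wu w1 ws p0 t0 (eta := eta) _ _ _ _ (t := b) st0 _) => //.
- by rewrite /eta mulrC divfK // expf_neq0 // pnatr_eq0.
- by rewrite expn_gt0.
- rewrite lef_pV2 ?posrE ?mulr_gt0 ?ltr0n ?container_loss_gt0 // mulrC ler_pM2l // ler_nat.
  rewrite container_lossS; apply: (@leq_trans (2 ^ j.+3 * 1)); last first.
    by rewrite leq_mul2l container_loss_gt0 orbT.
  by rewrite muln1 (@leq_exp2l 2 2).
- move=> Q [Q0 Qu Qd] leQ.
  have := IHj (fun S => eta^-1 * Q S) (theta * (2 ^ j.+3)%:R).
  rewrite container_lossS natrM mulrA => IH; apply: has_cocontainersW (IH _ _ _ _ _) => //.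
  + by move=> I iQ S SI; rewrite iQ // mulr0.
  + by rewrite mulr_gt0 ?ltr0n ?expn_gt0.
  + by move=> S; rewrite mulr_ge0 // invr_ge0 ltW.
  + by move=> S; rewrite mulf_eq0 => /norP[_ /Qu].
  + by rewrite /weight degZ -ler_pdivrMl ?invr_gt0 // invrK mulr1.
  move=> T T0; rewrite degZ ler_pdivrMl //; apply: le_trans (Qd T T0) _.
  rewrite -{1}(prednK (_ : 0 < #|T|)%N) ?card_gt0 // exprS.
  rewrite /eta natrX [2 ^+ j.+3]exprS.
  rewrite le_eqVlt; apply/orP; left; apply/eqP.
  by field; rewrite expf_neq0 // pnatr_eq0.
- rewrite weightE big1 // add0r ler_pdivlMr ?mulr_gt0 //; apply: le_trans leb.
  rewrite mulrA ler_pM2r // /eta mulrAC ler_pdivrMr ?exprn_gt0 //.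
  by rewrite ler_pM2l // -natrX (ler_nat _ 4) (@leq_exp2l 2 2).
Qed.
End Containers.

(** * Iterating the rounds *)

Section Iterate.
Local Open Scope ring_scope.
Variables (R : realFieldType) (V : finType).
Implicit Types (w Q : {set V} -> R) (S T I D X : {set V}) (p theta x y : R).

(** The member that avoids I :|: D0 is disjoint from [D0], so that a set [D0]
    already known to avoid [I] grows by a full amount [y]. *)
Lemma cocontainers_grow (P : {set V} -> Prop) (M : nat) y D0 :
    has_cocontainers P M y ->
  has_cocontainers (fun I => P (I :|: D0) /\ [disjoint D0 & I]) M (#|D0|%:R + y).
Proof.
move=> [F [sF cF bF]].
exists [seq D0 :|: D | D <- F & [disjoint D & D0]]; split.
- by rewrite size_map size_filter (leq_trans (count_size _ _)).
- move=> E /mapP[D]; rewrite mem_filter => /andP[dD DF] ->.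
  by rewrite cardsU setIC (disjoint_setI0 dD) cards0 subn0 natrD lerD2l cF.
move=> I [/bF[D DF +] dI].
rewrite -setI_eq0 setIUr setU_eq0 => /andP[/eqP DI /eqP DD0].
have D0I := disjoint_setI0 dI.
exists (D0 :|: D); last by rewrite -setI_eq0 setIUl D0I DI setU0.
by apply: map_f; rewrite mem_filter DF -setI_eq0 DD0 eqxx.
Qed.

Lemma cocontainers_bind (P : {set V} -> Prop) (M M' : nat) y x :
    has_cocontainers P M y ->
    (forall D, y <= #|D|%:R ->
       has_cocontainers (fun I => P I /\ [disjoint D & I]) M' x) ->
  has_cocontainers P (M * M') x.
Proof.
move=> [F [sF cF bF]] next.
have /fin_all_exists[G HG] D : exists G : seq {set V},
    [/\ (size G <= M')%N, forall E, E \in G -> x <= #|E|%:R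
      & y <= #|D|%:R -> forall I, P I /\ [disjoint D & I] ->
          exists2 E, E \in G & [disjoint E & I]].
  have [/next[G [sG cG bG]]|_] := leP y #|D|%:R; first by exists G.
  by exists [::].
exists (flatten [seq G D | D <- F]); split.
- apply: leq_trans (_ : size F * M' <= _)%N; last by rewrite leq_mul2r sF orbT.
  rewrite size_flatten /shape -map_comp; elim: (F) => //= D s IHs.
  by rewrite mulSn leq_add //; have [] := HG D.
- by move=> E /flatten_mapP[D _ EG]; have [_ + _] := HG D; apply.
- move=> I PI; have [D DF dD] := bF I PI; have [_ _ HD] := HG D.
  have [E EG dE] := HD (cF D DF) I (conj PI dD).
  by exists E => //; apply/flatten_mapP; exists D.
Qed.

Variables (J : finType) (B : {set J}) (phi : J -> {set V}).
Variables (j b : nat) (p theta : R).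
Hypotheses (phi_card : forall u, u \in B -> #|phi u| = j.+1).
Hypotheses (B_gt0 : (0 < #|B|)%N).
Hypotheses (p_gt0 : 0 < p) (theta_gt0 : 0 < theta) (le_b : p * #|V|%:R <= b%:R).
Hypothesis codeg : forall T, T != set0 ->
  2 * #|[set u in B | T \subset phi u]|%:R <= theta * p ^+ #|T|.-1 * #|B|%:R.

Definition copy_free I := forall u, u \in B -> ~~ (phi u \subset I).

(** The factor 2 makes the total weight at least 1 when at least half of the
    copies avoid [D0]. *)
Definition copy_weight (D0 S : {set V}) : R :=
  2 / #|B|%:R * #|[set u in B | (phi u == S) && [disjoint D0 & S]]|%:R.

Lemma deg_copy_weight D0 T : deg (copy_weight D0) T =
  2 / #|B|%:R * #|[set u in B | (T \subset phi u) && [disjoint D0 & phi u]]|%:R.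
Proof.
rewrite /deg /copy_weight -mulr_sumr -natr_sum; congr (_ * _%:R).
rewrite -sum1_card (partition_big phi (fun S => T \subset S)) /=; last first.
  by move=> u; rewrite inE => /and3P[].
apply: eq_bigr => S TS; rewrite -sum1_card; apply: eq_bigl => u; rewrite !inE.
by case: eqP => [->|_]; rewrite ?TS ?andbT ?andbF.
Qed.

(** By the codegree condition for singletons, fewer than 1 / theta points meet
    at most half of the copies: a union bound over the points of [D0]. *)
Lemma copy_weight_ge1 D0 : #|D0|%:R < theta^-1 -> 1 <= weight (copy_weight D0).
Proof.
move=> ltD; have B0 : 0 < #|B|%:R :> R by rewrite ltr0n.
rewrite /weight deg_copy_weight mulrAC ler_pdivlMr // mul1r.
pose hit := [set u in B | ~~ [disjoint D0 & phi u]].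
have -> : #|[set u in B | (set0 \subset phi u) && [disjoint D0 & phi u]]|%:R
   = #|B|%:R - #|hit|%:R :> R.
  rewrite -[in RHS](cardsID hit) natrD addrAC (_ : B :&: hit = hit) ?subrr ?add0r.
    congr (_%:R); apply: eq_card => u; rewrite !inE sub0set /=.
    by case: (u \in B); rewrite ?negbK ?andbT.
  by apply/setIidPr/subsetP => u; rewrite inE => /andP[].
suff : 2 * #|hit|%:R <= #|B|%:R :> R by move: #|hit|%:R #|B|%:R => h n; lra.
have le_hit : (#|hit| <= \sum_(v in D0) #|[set u in B | [set v] \subset phi u]|)%N.
  have sub : hit \subset \bigcup_(v in D0) [set u in B | [set v] \subset phi u].
    apply/subsetP => u; rewrite inE => /andP[uB]; rewrite -setI_eq0.
    move=> /set0Pn[v /setIP[vD vu]]; apply/bigcupP; exists v => //.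
    by rewrite inE uB sub1set.
  exact: leq_trans (subset_leq_card sub) (leq_card_bigcup _ _).
apply: le_trans (_ : \sum_(v in D0) theta * #|B|%:R <= _).
  apply: le_trans (_ : 2 * (\sum_(v in D0) #|[set u in B | [set v] \subset phi u]|)%:R <= _).
    by rewrite ler_pM2l // ler_nat.
  rewrite natr_sum mulr_sumr; apply: ler_sum => v _.
  have := codeg (T := [set v]); rewrite cards1 mulr1; apply.
  by rewrite -card_gt0 cards1.
rewrite sumr_const -[_ *+ _]mulr_natl mulrA ler_piMl ?ltW //.
by move: ltD; rewrite -[theta^-1]mul1r ltr_pdivlMr // => /ltW.
Qed.

Lemma copy_free_independent D0 I : copy_free I -> [disjoint D0 & I] ->
  independent (copy_weight D0) (I :|: D0).
Proof.
move=> fI dI S SI; rewrite /copy_weight (_ : [set u in B | _] = set0) ?cards0 ?mulr0 //.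
apply/setP => u; rewrite !inE; apply/negP => /and3P[uB /eqP uS dS].
case/negP: (fI u uB); rewrite uS; apply/subsetP => v vS.
have := subsetP SI v vS; rewrite inE => /orP[//|vD].
by rewrite (disjointFr dS vD) in vS.
Qed.

(** While [D0] is smaller than 1 / theta, the copies that avoid it still satisfy
    the hypotheses of [uniform_cocontainers], and each round enlarges [D0] by
    1 / (theta * container_loss j.+1). *)
Lemma iterated_cocontainers t D0 :
    theta^-1 <= #|D0|%:R + t%:R * (theta * (container_loss j.+1)%:R)^-1 ->
  has_cocontainers (fun I => copy_free I /\ [disjoint D0 & I])
    ((#|V|.+1 ^ (b * j)) ^ t) theta^-1.
Proof.
elim: t D0 => [|t IHt] D0 le_t.
  exists [:: D0]; split=> // [D|I [_ dI]].
    by rewrite inE => /eqP->; rewrite mul0r addr0 in le_t.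
  by exists D0; rewrite ?mem_head.
have [leD|ltD] := leP theta^-1 #|D0|%:R.
  exists [:: D0]; split=> [||I [_ dI]]; last by exists D0; rewrite ?mem_head.
    by rewrite expn_gt0 expn_gt0.
  by move=> D; rewrite inE => /eqP->.
have cont : has_cocontainers (independent (copy_weight D0)) (#|V|.+1 ^ (b * j))
    (theta * (container_loss j.+1)%:R)^-1.
  apply: uniform_cocontainers p_gt0 le_b theta_gt0 _ _ (copy_weight_ge1 ltD) _
    => [S|S|T T0].
  - by rewrite mulr_ge0 // divr_ge0.
  - rewrite mulf_eq0 negb_or pnatr_eq0 -lt0n card_gt0 => /andP[_].
    by move=> /set0Pn[u]; rewrite inE => /and3P[uB /eqP <- _]; exact: phi_card.
  rewrite deg_copy_weight mulrAC ler_pdivrMr ?ltr0n //; apply: le_trans (codeg T0).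
  rewrite ler_pM2l // ler_nat subset_leq_card //; apply/subsetP => u.
  by rewrite !inE => /and3P[-> ->].
have /has_cocontainersW grow := cocontainers_grow D0 cont.
rewrite expnS; apply: cocontainers_bind.
  apply: (grow (fun I => copy_free I /\ [disjoint D0 & I]) _ _ (leqnn _)).
  by move=> I [fI dI]; split=> //; exact: copy_free_independent.
move=> D leD; apply: has_cocontainersW (leqnn _) (IHt D _) => [I [[]]//|].
apply: le_trans le_t _.
by rewrite -[t.+1]add1n natrD mulrDl mul1r addrA lerD2r.
Qed.

Lemma copy_free_cocontainers :
  has_cocontainers copy_free (#|V|.+1 ^ (b * j * container_loss j.+1)) theta^-1.
Proof.
rewrite expnM.
apply: has_cocontainersW (leqnn _)
  (@iterated_cocontainers (container_loss j.+1) set0 _) => [I fI|].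
  by rewrite disjoint_sym -setI_eq0 setI0 eqxx.
rewrite cards0 add0r invfM mulrCA divff ?mulr1 // pnatr_eq0 -lt0n.
exact: container_loss_gt0.
Qed.
End Iterate.

(** * Codegrees of cliques *)

Lemma bin_codegree_step n r u : u < r -> r <= n ->
  'C(n - u.+1, r - u.+1) * n <= r * 'C(n - u, r - u).
Proof.
move=> ur rn.
have nu : 0 < n - u by lia.
have diag : (n - u) * 'C(n - u.+1, r - u.+1) = (r - u) * 'C(n - u, r - u).
  have -> : r - u = (r - u.+1).+1 by lia.
  by rewrite -mul_bin_diag; congr (_ * 'C(_, _)); lia.
have le_ratio : (r - u) * n <= r * (n - u) by nia.
rewrite -(leq_pmul2l nu) mulnA diag mulnAC mulnCA mulnA.
by rewrite leq_mul2r le_ratio orbT.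
Qed.

Lemma bin_trinomial n r l : l <= r -> r <= n ->
  'C(n - l, r - l) * 'C(n, l) = 'C(r, l) * 'C(n, r).
Proof.
move=> lr rn; have ln := leq_trans lr rn.
apply/eqP; rewrite -(eqn_pmul2r (_ : 0 < l`! * (r - l)`! * (n - r)`!)); last first.
  by rewrite !muln_gt0 !fact_gt0.
apply/eqP; have rl : r - l <= n - l by lia.
transitivity n`!.
  rewrite -(bin_fact ln) -[in RHS](bin_fact rl) (_ : n - l - (r - l) = n - r); last by lia.
  ring.
by rewrite -(bin_fact rn) -[in LHS](bin_fact lr); ring.
Qed.

(** The number of r-sets containing a given set of l + e points, as a proportion
    of all r-sets, is at most ('C(r, l) / 'C(n, l)) * (r / n) ^ e: there is
    equality for e = 0, and each further point costs a factor
    (r - u) / (n - u) <= r / n. *)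
Lemma bin_codegree_le n r l e : l + e <= r -> r <= n ->
  'C(n - (l + e), r - (l + e)) * 'C(n, l) * n ^ e <= 'C(r, l) * r ^ e * 'C(n, r).
Proof.
move=> + rn; elim: e => [|e IHe] le_r.
  by rewrite addn0 in le_r *; rewrite !expn0 !muln1 bin_trinomial.
rewrite addnS in le_r *; have := IHe (ltnW le_r).
have := @bin_codegree_step n r (l + e) le_r rn; rewrite !expnS.
move: 'C(_ - _.+1, _) 'C(_ - (_ + _), _) => c1 c0 h1 h2.
rewrite (_ : c1 * _ * _ = c1 * n * ('C(n, l) * n ^ e)); last by ring.
rewrite (_ : 'C(r, l) * _ * _ = r * ('C(r, l) * r ^ e * 'C(n, r))); last by ring.
apply: leq_trans (leq_mul h1 (leqnn _)) _.
by rewrite -mulnA leq_mul2l mulnA h2 orbT.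
Qed.

(** The exponent 'C(r.-1, l.-1) in the choice of p comes from here: adding a
    point to a set of size at most r - 1 creates at most 'C(r.-1, l.-1) new
    l-subsets. *)
Lemma bin_le_span r l e : 0 < l -> l + e <= r ->
  'C(l + e, l) <= (e * 'C(r.-1, l.-1)).+1.
Proof.
move=> l0; elim: e => [|e IHe] le_r; first by rewrite addn0 binn.
have := IHe (ltnW _); rewrite -addnS => /(_ le_r).
have : 'C(l + e, l.-1) <= 'C(r.-1, l.-1) by apply: leq_bin2l; lia.
have : 'C(l + e.+1, l) = 'C(l + e, l) + 'C(l + e, l.-1).
  by rewrite addnS -{2 4}(prednK l0) binS (prednK l0).
by rewrite mulSn; lia.
Qed.

Section Cliques.
Variables (n l : nat).
Definition edge := {e : {set 'I_n} | #|e| == l}.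
Definition clique (U : {set 'I_n}) : {set edge} := [set e : edge | val e \subset U].

Lemma card_edge : #|{: edge}| = 'C(n, l).
Proof. by rewrite card_sig -cardsE card_draws card_ord. Qed.

Lemma card_clique U : #|clique U| = 'C(#|U|, l).
Proof.
rewrite -cards_draws -(card_imset _ val_inj); apply: eq_card => e.
rewrite !inE; apply/imsetP/andP => [[f]|[eU el]]; last first.
  by exists (exist _ e el) => //; rewrite inE.
by rewrite inE => fU ->; rewrite (valP f).
Qed.

Lemma card_supersets (W : {set 'I_n}) r : #|W| <= r ->
  #|[set U : {set 'I_n} | (#|U| == r) && (W \subset U)]| = 'C(n - #|W|, r - #|W|).
Proof.
move=> Wr; have -> : n - #|W| = #|~: W| by rewrite [RHS]cardsCs setCK card_ord.
rewrite -cards_draws; rewrite -[RHS](card_in_imset (f := fun A => A :|: W)).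
  apply: eq_card => U; rewrite !inE; apply/andP/imsetP => [[/eqP Ur WU]|[A]].
    exists (U :\: W); last by rewrite setUC -{1}(setIidPr WU) setUC setUC setID.
    by rewrite !inE setDE subsetIr /= -setDE cardsD (setIidPr WU) Ur.
  rewrite inE => /andP[AW /eqP cA] ->; rewrite subsetUr; split=> //.
  have dAW : A :&: W = set0 by apply/eqP; rewrite setI_eq0 disjoints_subset.
  by rewrite cardsU dAW cards0 subn0 cA subnK.
move=> A A'; rewrite !inE => /andP[AW _] /andP[AW' _] eqAA'.
have aux (A0 : {set 'I_n}) : A0 \subset ~: W -> (A0 :|: W) :&: ~: W = A0.
  by move=> AW0; rewrite setIUl setICr setU0; exact/setIidPl.
by rewrite -(aux A) // eqAA' aux.
Qed.

End Cliques.

Section CliqueFree.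
Local Open Scope ring_scope.

(** With p = 1 / x the assumption on [n] reads p ^ 'C(r.-1, l.-1) = r / n, so
    the codegree condition follows from [bin_codegree_le] and [bin_le_span]
    applied to the vertices covered by a set of edges. *)
Lemma clique_free_cocontainers n r l b (x : nat) :
    (0 < l)%N -> (l <= r)%N -> (0 < x)%N -> n = (r * x ^ 'C(r.-1, l.-1))%N ->
    ('C(n, l) <= b * x)%N ->
  exists F : seq {set edge n l},
    [/\ (size F <= 'C(n, l).+1 ^ (b * 'C(r, l).-1 * container_loss 'C(r, l)))%N,
        forall D, D \in F -> ('C(n, l) <= 2 * 'C(r, l) * #|D|)%N
      & forall I : {set edge n l},
          (forall U : {set 'I_n}, #|U| = r -> ~~ (clique l U \subset I)) ->
          exists2 D, D \in F & [disjoint D & I]].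
Proof.
move=> l0 lr x0 n_def le_b.
have rn : (r <= n)%N by rewrite n_def leq_pmulr // expn_gt0 x0.
have s0 : (0 < 'C(r, l))%N by rewrite bin_gt0.
have N0 : (0 < 'C(n, l))%N by rewrite bin_gt0 (leq_trans lr).
have r0 := leq_trans l0 lr; have n0 := leq_trans r0 rn.
pose theta : rat := 2 * ('C(r, l))%:R / ('C(n, l))%:R.
pose p : rat := x%:R^-1.
have theta0 : 0 < theta by rewrite divr_gt0 ?mulr_gt0 ?ltr0n.
have p0 : 0 < p by rewrite invr_gt0 ltr0n.
pose B := [set U : {set 'I_n} | #|U| == r].
have cB : #|B| = 'C(n, r) by rewrite card_draws card_ord.
case: (@copy_free_cocontainers _ (edge n l : finType) _ B (@clique n l)
  ('C(r, l).-1) b p theta).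
- by move=> U; rewrite inE => /eqP rU; rewrite card_clique rU prednK.
- by rewrite cB bin_gt0.
- by [].
- by [].
- by rewrite card_edge mulrC ler_pdivrMr ?ltr0n // -natrM ler_nat.
- move=> T T0.
  (* A clique contains the edges in T iff its vertex set contains W. *)
  pose W := \bigcup_(e in T) val e.
  have -> : [set U in B | T \subset clique l U]
     = [set U : {set 'I_n} | (#|U| == r) && (W \subset U)].
    apply/setP => U; rewrite !inE; congr (_ && _); apply/subsetP/bigcupsP => TU e eT.
      by have := TU e eT; rewrite inE.
    by rewrite inE TU.
  have [rW|Wr] := ltnP r #|W|.
    rewrite (_ : [set U : {set 'I_n} | _] = set0) ?cards0 ?mulr0.
      by rewrite mulr_ge0 // mulr_ge0 ?exprn_ge0 // ltW.
    apply/setP => U; rewrite !inE; apply/negP => /andP[/eqP rU /subset_leq_card].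
    by rewrite rU leqNgt rW.
  rewrite card_supersets // cB.
  have lW : (l <= #|W|)%N.
    case/set0Pn: T0 => e eT; rewrite -(eqP (valP e)); apply: subset_leq_card.
    exact: (bigcup_sup e).
  have leT : (#|T| <= 'C(#|W|, l))%N.
    rewrite -card_clique subset_leq_card //; apply/subsetP => e eT.
    by rewrite inE; exact: (bigcup_sup e).
  rewrite -(subnKC lW) in Wr leT *; move: (#|W| - l)%N Wr leT => e {lW} Wr leT.
  have le_pe : (r%:R / n%:R) ^+ e <= p ^+ #|T|.-1.
    have -> : r%:R / n%:R = p ^+ 'C(r.-1, l.-1) :> rat.
      rewrite n_def natrM natrX invfM mulrA divff ?mul1r ?exprVn //.
      by rewrite pnatr_eq0 -lt0n.
    rewrite -exprM ler_wiXn2l //; first exact: ltW.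
      by rewrite invf_le1 ?ltr0n // ler1n.
    rewrite mulnC -ltnS prednK ?card_gt0 //.
    exact: leq_trans leT (bin_le_span l0 Wr).
  have := bin_codegree_le Wr rn.
  rewrite -(ler_nat rat) !natrM !natrX => ratio.
  apply: le_trans (_ : theta * (r%:R / n%:R) ^+ e * ('C(n, r))%:R <= _); last first.
    by rewrite ler_wpM2r // ler_pM2l.
  rewrite /theta expr_div_n.
  rewrite -mulrA -[2 * _ / _]mulrA -!mulrA ler_pM2l //.
  have nR0 : 0 < n%:R ^+ e :> rat by rewrite exprn_gt0 ?ltr0n.
  have NR0 : 0 < ('C(n, l))%:R :> rat by rewrite ltr0n.
  rewrite -(ler_pM2r NR0) -(ler_pM2r nR0); apply: (le_trans ratio).
  rewrite le_eqVlt; apply/orP; left; apply/eqP; field.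
  by rewrite !gt_eqF.
move=> F [sF cF bF]; exists F; split=> [|D DF|I fI].
- by rewrite card_edge prednK // in sF.
- have := cF D DF; rewrite /theta invf_div ler_pdivrMr ?mulr_gt0 ?ltr0n //.
  by rewrite -!natrM ler_nat mulnC.
- by apply: bF => U; rewrite inE => /eqP; exact: fI.
Qed.

End CliqueFree.

(** * Random lists *)

(** This is (1 - 1 / a) ^ a <= 1 / 2, by Bernoulli: in the union bound every
    [a] good points pay for one bit. *)
Lemma double_pred_exp a : 0 < a -> 2 * a.-1 ^ a <= a ^ a.
Proof.
case: a => // c _.
have bernoulli j : c ^ j * (c + j) <= c.+1 ^ j * c.
  elim: j => [|j IHj]; first by rewrite !expn0 addn0.
  rewrite !expnS; nia.
have := bernoulli c.+1; case: c {bernoulli} => [//|c] /=.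
rewrite -(leq_pmul2r (_ : 0 < c.+1)) //; move: (c.+1 ^ _) (c.+2 ^ _); nia.
Qed.

(** A random k-subset of m colours falls into a given set of q colours with
    probability at least c ^ - k, since each of the successive choices does so
    with probability at least 1 / c. *)
Lemma bin_le_exp_mul c m q k :
  c * k <= m -> 2 * m <= c * q -> 'C(m, k) <= c ^ k * 'C(q, k).
Proof.
move=> ck cq; rewrite -(leq_pmul2r (fact_gt0 k)) -mulnA !bin_ffact.
have : forall i, i <= k -> m ^_ i <= c ^ i * q ^_ i.
  elim=> [|i IHi] ik; first by rewrite !ffactn0.
  rewrite !ffactnSr expnSr mulnACA leq_mul ?(IHi (ltnW ik)) // mulnBr.
  have : c * i <= c * k by rewrite leq_mul2l (ltnW ik) orbT.
  by lia.
by apply.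
Qed.

Section Lists.
Variables (V : finType) (s k T : nat) (F : seq {set V}).
Let m := 8 * s * k.
Let a := (8 * s) ^ k.
Hypotheses (s_gt0 : 0 < s) (k_gt0 : 0 < k).
Hypothesis F_large : forall D, D \in F -> #|V| <= 2 * s * #|D|.
Hypothesis F_size : size F <= 2 ^ T.
Hypothesis V_large : 4 * s * (a * (T * m).+1) <= #|V|.

(** [D] guesses, for every colour, a member of [F] avoiding its class; the
    colours in [missed D v] can then not be used on [v]. *)
Let missed (D : {ffun 'I_m -> 'I_(size F)}) v : {set 'I_m} :=
  [set i | v \in nth set0 F (D i)].
Let good D := [set v | m <= 4 * s * #|missed D v|].
Let lists : {set {ffun V -> {set 'I_m}}} :=
  [set L : {ffun V -> {set 'I_m}} | [forall v, #|L v| == k]].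
Let coverable D : {set {ffun V -> {set 'I_m}}} :=
  [set L in lists | [forall v, ~~ (L v \subset missed D v)]].

(** Averaging: by double counting a point is missed by m / (2 * s) colours on
    average, and by at most m of them, so a proportion 1 / (4 * s) of the points
    is missed by at least half of that average. *)
Let card_good D : a * (T * m).+1 <= #|good D|.
Proof.
have m0 : 0 < m by rewrite !muln_gt0 s_gt0 k_gt0.
have sum_missed : \sum_v #|missed D v| = \sum_i #|nth set0 F (D i)|.
  under eq_bigr => v _ do rewrite -sum1_card.
  rewrite (exchange_big_dep predT) //=; apply: eq_bigr => i _.
  by rewrite -sum1_card; apply: eq_bigl => v; rewrite inE.
have le1 : m * #|V| <= 2 * s * \sum_v #|missed D v|.
  rewrite sum_missed big_distrr /= -[m in leqLHS]card_ord -sum_nat_const.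
  by apply: leq_sum => i _; apply: F_large; rewrite mem_nth.
have le2 : 4 * s * \sum_v #|missed D v| <= 4 * s * (m * #|good D|) + m * #|V|.
  have -> : 4 * s * (m * #|good D|) + m * #|V|
      = \sum_v ((if v \in good D then 4 * s * m else 0) + m).
    rewrite big_split /= -big_mkcond !sum_nat_const; congr (_ + _); first by ring.
    by rewrite mulnC; congr (_ * _); apply: eq_card.
  rewrite big_distrr /=; apply: leq_sum => v _; rewrite inE.
  case: ifPn => [_|]; last by rewrite -ltnNge => /ltnW.
  apply: leq_trans (leq_addr _ _); rewrite leq_mul2l.
  by rewrite -[m in leqRHS]card_ord max_card orbT.
rewrite -(leq_pmul2l (_ : 0 < 4 * s)) ?muln_gt0 //; apply: leq_trans V_large _.
rewrite -(leq_pmul2l m0); nia.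
Qed.

Let card_draws_not_sub (A : {set 'I_m}) :
  #|[set X : {set 'I_m} | (#|X| == k) && ~~ (X \subset A)]| = 'C(m, k) - 'C(#|A|, k).
Proof.
have -> : 'C(m, k) = #|[set X : {set 'I_m} | #|X| == k]| by rewrite card_draws card_ord.
rewrite -cards_draws.
rewrite -cardsDS; last by apply/subsetP => X; rewrite !inE => /andP[].
apply: eq_card => X; rewrite !inE negb_and andbC.
by case: (#|X| == k); rewrite ?andbT ?andbF ?orbF.
Qed.

Let card_lists : #|lists| = 'C(m, k) ^ #|V|.
Proof.
have -> : #|lists| = #|family (fun _ : V => [set X : {set 'I_m} | #|X| == k])|.
  apply: eq_card => L; rewrite !inE; apply/forallP/familyP => hL v.
    by rewrite inE hL.
  by have := hL v; rewrite inE.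
rewrite card_family foldrE big_map big_enum /=.
by rewrite prod_nat_const card_draws card_ord.
Qed.

(** Lists at different points are independent, and each good point contributes
    a factor at most 1 - 1 / a. *)
Let card_coverable D :
  a ^ #|good D| * #|coverable D| <= a.-1 ^ #|good D| * 'C(m, k) ^ #|V|.
Proof.
have -> : #|coverable D| = #|family (fun v : V =>
    [set X : {set 'I_m} | (#|X| == k) && ~~ (X \subset missed D v)])|.
  apply: eq_card => L; rewrite !inE; apply/andP/familyP.
    by move=> [/forallP h1 /forallP h2] v; rewrite inE h1 h2.
  by move=> h; split; apply/forallP => v; have := h v; rewrite inE => /andP[].
rewrite card_family foldrE big_map big_enum /= -!prod_nat_const.
rewrite [\prod_(i in good D) a]big_mkcond [\prod_(i in good D) a.-1]big_mkcond.
rewrite -!big_split /=; apply: leq_prod => v _.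
rewrite card_draws_not_sub; case: ifP => [|_]; last by rewrite !mul1n leq_subr.
rewrite inE => v_good.
have : 'C(m, k) <= a * 'C(#|missed D v|, k).
  apply: bin_le_exp_mul => //.
  by rewrite (_ : 8 * s * _ = 2 * (4 * s * #|missed D v|)) ?leq_mul2l //; ring.
rewrite mulnBr -subn1 mulnBl mul1n => ?; exact: leq_sub2l.
Qed.

(** Union bound over the at most 2 ^ (T * m) guesses [D]: each is compatible with
    at most a proportion 2 ^ - (T * m + 1) of the list assignments, because the
    number of good points is at least a * (T * m + 1). *)
Lemma lists_defeating_family : exists L : V -> {set 'I_m},
  (forall v, #|L v| = k) /\
  (forall D : 'I_m -> {set V}, (forall i, D i \in F) ->
     exists v, L v \subset [set i | v \in D i]).
Proof.
have a0 : 0 < a by rewrite expn_gt0 muln_gt0 s_gt0.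
have C0 : 0 < 'C(m, k) by rewrite bin_gt0 leq_pmull // muln_gt0.
have [sub|] := boolP (lists \subset \bigcup_D coverable D).
  exfalso.
  pose g := a * (T * m).+1.
  have dbl : 2 ^ (T * m).+1 * a.-1 ^ g <= a ^ g.
    by rewrite /g !expnM -expnMn leq_exp2r // double_pred_exp.
  have cov D : 2 ^ (T * m).+1 * #|coverable D| <= 'C(m, k) ^ #|V|.
    have aG : 0 < a ^ #|good D| by rewrite expn_gt0 a0.
    rewrite -(leq_pmul2l aG) mulnCA.
    apply: leq_trans (leq_mul (leqnn _) (card_coverable D)) _.
    rewrite mulnA leq_mul2r; apply/orP; right.
    rewrite -(subnKC (card_good D)) !expnD mulnA leq_mul //.
    by case: (_ - _) => [|e] //; rewrite leq_exp2r ?leq_pred.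
  have := subset_leq_card sub; rewrite card_lists => le_card.
  have le_sum : 'C(m, k) ^ #|V| <= \sum_D #|coverable D|.
    exact: leq_trans le_card (leq_card_bigcup _ _).
  have : 2 ^ (T * m).+1 * 'C(m, k) ^ #|V| <= 2 ^ (T * m) * 'C(m, k) ^ #|V|.
    apply: leq_trans (_ : 2 ^ (T * m).+1 * \sum_D #|coverable D| <= _).
      by rewrite leq_mul2l le_sum orbT.
    rewrite big_distrr /=.
    apply: leq_trans
      (_ : \sum_(D : {ffun 'I_m -> 'I_(size F)}) 'C(m, k) ^ #|V| <= _).
      by apply: leq_sum => D _; exact: cov.
    rewrite sum_nat_const card_ffun !card_ord leq_mul2r expnM leq_exp2r.
      by rewrite F_size orbT.
    by rewrite !muln_gt0 s_gt0 k_gt0.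
  by rewrite leq_pmul2r ?expn_gt0 ?C0 // leq_exp2l // ltnn.
move=> /subsetPn[L]; rewrite inE => /forallP Lk Lcov; exists L; split=> [v|D DF].
  exact/eqP.
have idx i : index (D i) F < size F by rewrite index_mem.
have [/existsP[v Lv]|nex] := boolP [exists v, L v \subset [set i | v \in D i]].
  by exists v.
case/negP: Lcov; apply/bigcupP; exists [ffun i => Ordinal (idx i)] => //.
rewrite !inE; apply/andP; split; first by apply/forallP => v; exact: Lk.
apply/forallP => v; move/existsPn/(_ v): nex.
rewrite (_ : missed _ v = [set i | v \in D i]) //.
by apply/setP => i; rewrite !inE ffunE /= nth_index.
Qed.
End Lists.

(** * Choice of the number of vertices *)

Lemma container_loss_le j : container_loss j <= 2 ^ (j * j.+1).
Proof.
elim: j => [|[|j] IHj] //; rewrite container_lossS.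
apply: leq_trans (leq_mul (leqnn _) IHj) _.
by rewrite -expnD leq_exp2l //; nia.
Qed.

Lemma sqr_le_exp k : k ^ 2 <= 2 ^ k.+1.
Proof.
case: k => [|[|[|k]]] //; elim: k => [//|k IHk].
by rewrite expnS; apply: leq_trans (leq_mul (leqnn 2) IHk); nia.
Qed.

Lemma ffact_le_exp n m : n ^_ m <= n ^ m.
Proof.
elim: m => [|m IHm]; first by rewrite ffactn0.
by rewrite ffactnSr expnSr leq_mul // leq_subr.
Qed.

Lemma fact_bin_le n m : m`! * 'C(n, m) <= n ^ m.
Proof. by rewrite mulnC bin_ffact ffact_le_exp. Qed.

Lemma bin_le_exp n m : 'C(n, m) <= n ^ m.
Proof. by apply: leq_trans (fact_bin_le n m); rewrite leq_pmull ?fact_gt0. Qed.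

Section VertexCount.
Variables (r l k : nat).
Hypotheses (l_gt1 : 1 < l) (le_lr : l <= r) (k_gt0 : 0 < k).

(** The value of 1 / p. The first factor absorbs [container_loss] and all
    polynomial factors in r ^ l, the second one the probability (8 * s) ^ - k
    of a list of missed colours, with a factor 2 ^ k to spare for the powers
    of [k]. *)
Definition sparsity : nat := 2 ^ (3 * (r ^ l) ^ 2) * r ^ ((l + 2) * k).
Definition list_order : nat := r * sparsity ^ 'C(r.-1, l.-1).

Let r_gt1 : 1 < r. Proof. exact: leq_trans le_lr. Qed.
Let r_gt0 : 0 < r. Proof. exact: ltnW. Qed.
Let rho := r ^ l.
Let s := 'C(r, l).
Let d := 'C(r.-1, l.-1).

Let rho_ge4 : 4 <= rho.
Proof.
apply: leq_trans (_ : 2 ^ l <= _); first by rewrite (@leq_exp2l 2 2).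
by rewrite /rho leq_exp2r // ltnW.
Qed.

Let le_r_rho : r <= rho.
Proof. by rewrite -[r in leqLHS]expn1 leq_exp2l // ltnW. Qed.

Let s_le : 2 * s <= rho.
Proof.
apply: leq_trans (fact_bin_le r l); rewrite leq_mul2r; apply/orP; right.
by apply: leq_trans l_gt1 (fact_geq l).
Qed.

Let s_gt0 : 0 < s. Proof. by rewrite bin_gt0. Qed.
Let d_gt0 : 0 < d. Proof. by rewrite bin_gt0; lia. Qed.

Let d_le : (l.-1)`! * d <= r ^ l.-1.
Proof.
apply: leq_trans (fact_bin_le _ _) _.
by rewrite leq_exp2r ?leq_pred //; lia.
Qed.

Let d_le' : d <= r ^ l.-1.
Proof. by apply: leq_trans d_le; rewrite leq_pmull ?fact_gt0. Qed.

Let s_le_exp : 16 * s <= r ^ (l + 2).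
Proof.
have [r2|r3] := leqP r 2.
  have r_2 : r = 2 by lia. have l_2 : l = 2 by lia.
  by rewrite /s r_2 l_2.
rewrite expnD; have r8 : 8 <= r ^ 2 by rewrite (@leq_trans (3 ^ 2)) // leq_exp2r.
by have := s_le; rewrite -/rho; nia.
Qed.

Lemma sparsity_gt0 : 0 < sparsity.
Proof. by rewrite muln_gt0 !expn_gt0 r_gt0. Qed.

Lemma le_r_list_order : r <= list_order.
Proof. by rewrite leq_pmulr // expn_gt0 sparsity_gt0. Qed.

Lemma sparsity_le_bin : sparsity <= 'C(list_order, l).
Proof.
have l_gt0 : 0 < l by lia.
rewrite -(leq_pmul2l l_gt0).
have -> : l * 'C(list_order, l) = list_order * 'C(list_order.-1, l.-1).
  by rewrite -{1 2}(prednK l_gt0) -mul_bin_diag.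
apply: (@leq_trans list_order); last first.
  by rewrite leq_pmulr // bin_gt0; have := le_r_list_order; lia.
rewrite /list_order leq_mul // -[sparsity in leqLHS]expn1 leq_pexp2l //.
exact: sparsity_gt0.
Qed.

(** The two factors of [sparsity] are raised to the power
    d <= r ^ (l - 1) / (l - 1)!, and l + 2 <= 4 * (l - 1)! for 2 <= l. *)
Lemma list_order_le :
  list_order <= 2 ^ (4 * r ^ (3 * l - 1)) * r ^ (4 * k * r ^ (l - 1)).
Proof.
have e1 : rho ^ 2 * r ^ l.-1 = r ^ (3 * l - 1).
  by rewrite /rho -expnM -expnD; congr (_ ^ _); lia.
have ll : l + 2 <= 4 * (l.-1)`!.
  case: (l) l_gt1 => [//|[//|[//|j]]] _ /=.
  by have := fact_geq j.+2; lia.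
have e2 : 2 ^ (4 * r ^ (3 * l - 1)) = 2 ^ r ^ (3 * l - 1) * 2 ^ (3 * rho ^ 2 * r ^ l.-1).
  by rewrite -expnD -mulnA e1 -mulSn.
rewrite e2 /list_order /sparsity -/rho -/d expnMn -(expnM 2) -(expnM r) mulnA.
apply: leq_mul; first apply: leq_mul.
- apply: leq_trans (ltnW (ltn_expl _ (isT : 1 < 2))); rewrite -{1}[r]expn1.
  by rewrite leq_exp2l //; lia.
- by rewrite leq_exp2l // leq_mul2l d_le' orbT.
rewrite leq_exp2l // subn1; have := leq_mul ll (leqnn d).
by have := d_le; nia.
Qed.

Lemma list_order_bin_lt : 'C(list_order, l).+1 <= 2 ^ (7 * rho ^ 4 * k).
Proof.
have r2 : r <= 2 ^ rho by apply: leq_trans le_r_rho (ltnW (ltn_expl _ _)).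
have d_rho : d <= rho.
  by apply: leq_trans d_le' _; rewrite /rho leq_exp2l // leq_pred.
have l_rho : l <= rho by apply: leq_trans le_lr le_r_rho.
have x2 : sparsity <= 2 ^ (3 * rho ^ 2 + rho * ((l + 2) * k)).
  by rewrite expnD leq_mul // [leqRHS]expnM leq_exp2r //; nia.
have n2 : list_order <= 2 ^ (rho + (3 * rho ^ 2 + rho * ((l + 2) * k)) * d).
  by rewrite expnD leq_mul // expnM leq_exp2r.
have N2 : 'C(list_order, l) <= 2 ^ ((rho + (3 * rho ^ 2 + rho * ((l + 2) * k)) * d) * l).
  apply: leq_trans (bin_le_exp _ _) _.
  by rewrite expnM leq_exp2r // ltnW.
apply: (@leq_trans (2 ^ ((rho + (3 * rho ^ 2 + rho * ((l + 2) * k)) * d) * l).+1)).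
  by rewrite expnS mul2n -addnn -addn1 leq_add // expn_gt0.
rewrite leq_exp2l //.
have h1 : (rho + (3 * rho ^ 2 + rho * ((l + 2) * k)) * d) * l <=
    (rho + (3 * rho ^ 2 + rho * ((2 * rho) * k)) * rho) * rho.
  rewrite leq_mul // leq_add2l leq_mul // leq_add2l leq_mul2l leq_mul2r.
  by apply/orP; right; apply/orP; right; lia.
apply: leq_ltn_trans h1 _.
have -> : (rho + (3 * rho ^ 2 + rho * (2 * rho * k)) * rho) * rho
  = rho ^ 2 + 3 * rho ^ 4 + 2 * (rho ^ 4 * k) by ring.
rewrite -mulnA; have h4 : rho ^ 4 <= rho ^ 4 * k by rewrite leq_pmulr.
have h5 : rho ^ 2 < rho ^ 4 by rewrite ltn_exp2l //; lia.
by lia.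
Qed.

Lemma sparsity_ge :
  64 * s ^ 3 * k * container_loss s * (7 * rho ^ 4 * k) * (8 * s) ^ k <= sparsity.
Proof.
have h1 : 2 ^ k * (8 * s) ^ k <= r ^ ((l + 2) * k).
  by rewrite -expnMn expnM leq_exp2r // mulnA.
have h2 := sqr_le_exp k.
have h3 : 2 ^ 7 * rho ^ 7 * container_loss s <= 2 ^ (3 * rho ^ 2).
  have rho2 : rho ^ 7 <= 2 ^ (rho * 7).
    by rewrite expnM leq_exp2r // ltnW // ltn_expl.
  apply: leq_trans (leq_mul (leq_mul (leqnn _) rho2) (container_loss_le s)) _.
  rewrite -!expnD leq_exp2l //.
  by move: s_le rho_ge4; move: rho s => t u; nia.
have h4 : 2 ^ 3 * s ^ 3 <= rho ^ 3 by rewrite -expnMn leq_exp2r.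
rewrite /sparsity -/rho.
apply: leq_trans (leq_mul h3 h1).
have -> : 64 * s ^ 3 * k * container_loss s * (7 * rho ^ 4 * k) * (8 * s) ^ k
  = (56 * rho ^ 4 * container_loss s * (8 * s) ^ k) * ((2 ^ 3 * s ^ 3) * k ^ 2) by ring.
apply: leq_trans (leq_mul (leqnn _) (leq_mul h4 h2)) _.
rewrite [leqLHS](_ : _ = 112 * (rho ^ 7 * container_loss s * (2 ^ k * (8 * s) ^ k))).
  rewrite [leqRHS](_ : _ = 128 * (rho ^ 7 * container_loss s * (2 ^ k * (8 * s) ^ k))).
    by rewrite leq_mul2r orbT.
  by ring.
by rewrite (expnS 2 k); ring.
Qed.

(** An upper bound for the binary logarithm of the size of the family of
    [clique_free_cocontainers], by [list_order_bin_lt]. *)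
Definition container_bits : nat :=
  7 * (r ^ l) ^ 4 * k * (('C(list_order, l) %/ sparsity).+1 * s.-1 * container_loss s).

Lemma union_bound_room :
  4 * s * ((8 * s) ^ k * (container_bits * (8 * s * k)).+1) <= 'C(list_order, l).
Proof.
rewrite /container_bits -/rho; set T := _ * _ * k * _.
have x0 := sparsity_gt0; have xN := sparsity_le_bin; have key := sparsity_ge.
set N := 'C(list_order, l) in T xN *; set x := sparsity in T x0 xN key *.
set b := (N %/ x).+1 in T *; set Lam := 7 * rho ^ 4 * k in T key *.
have bx : b * x <= 2 * N.
  by rewrite [leqLHS]mulSn mul2n -addnn leq_add // leq_trunc_div.
have Lam0 : 0 < Lam by rewrite !muln_gt0 expn_gt0 k_gt0; lia.
have T_le : (T * (8 * s * k)).+1 <= Lam * b * s * container_loss s * (8 * s * k).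
  have q0 : 0 < Lam * b * container_loss s * (8 * s * k).
    rewrite (muln_gt0 (_ * container_loss s)) (muln_gt0 (Lam * b)) (muln_gt0 Lam) Lam0.
    rewrite container_loss_gt0.
    by rewrite !muln_gt0 s_gt0 k_gt0.
  rewrite [leqRHS](_ : _ = T * (8 * s * k) + Lam * b * container_loss s * (8 * s * k)).
    by rewrite -addn1 leq_add2l.
  by rewrite /T -{1}(prednK s_gt0); ring.
rewrite -(leq_pmul2l (isT : 0 < 2)); apply: leq_trans bx.
apply: leq_trans (leq_mul (leqnn _) (leq_mul (leqnn _) (leq_mul (leqnn _) T_le))) _.
apply: leq_trans (leq_mul (leqnn b) key).
by rewrite leq_eqVlt; apply/orP; left; apply/eqP; ring.
Qed.

End VertexCount.

(** * Colourings of the complete hypergraph *)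

Lemma exists_subset_card (T : finType) (A : {set T}) r :
  (r <= #|A|)%N -> exists2 U : {set T}, U \subset A & #|U| = r.
Proof.
move=> rA; have : (0 < #|[set U : {set T} | (U \subset A) && (#|U| == r)]|)%N.
  by rewrite cards_draws bin_gt0.
by move=> /card_gt0P[U]; rewrite inE => /andP[UA /eqP Ur]; exists U.
Qed.

Lemma monochromatic_copy_of_set n r l (c : {set 'I_n} -> nat) (U : {set 'I_n}) a :
    #|U| = r -> (forall e : {set 'I_n}, e \subset U -> #|e| = l -> c e = a) ->
  @has_monochromatic_copy l (complete_uhypergraph r l) (complete_uhypergraph n l) c.
Proof.
move=> Ur cU; pose f (i : 'I_r) : 'I_n := enum_val (cast_ord (esym Ur) i).
have f_inj : injective f by move=> i j /enum_val_inj/cast_ord_inj.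
exists [set f @: e | e : {set 'I_r} in complete_edges r l]; split.
  split; last by exists f.
  apply/subsetP => e' /imsetP[e]; rewrite !inE => /eqP el ->.
  by rewrite card_imset ?el.
exists a => e' /imsetP[e]; rewrite inE => /eqP el ->; apply: cU.
  by apply/subsetP => _ /imsetP[i _ ->]; exact: enum_valP.
by rewrite card_imset.
Qed.

Definition colours_of m (A : {set 'I_m}) : {fset nat} :=
  [fset x in [seq val i | i <- enum A]]%fset.

Lemma card_colours_of m (A : {set 'I_m}) : #|` colours_of A| = #|A|.
Proof.
rewrite card_fseq undup_id ?size_map -?cardE //.
by rewrite map_inj_uniq ?enum_uniq //; exact: val_inj.
Qed.

Lemma colours_ofP m (A : {set 'I_m}) x :
  x \in colours_of A -> exists2 i, i \in A & x = val i.
Proof.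
by rewrite /colours_of in_fset => /mapP[i]; rewrite mem_enum => iA ->; exists i.
Qed.

(** A colouring without monochromatic clique provides for each colour a member of
    the family avoiding its class. The edge whose list consists of colours
    missing it then has no possible colour. *)
Lemma list_ramsey_property_list_order r l k : (1 < l)%N -> (l <= r)%N -> (0 < k)%N ->
  list_ramsey_property (complete_uhypergraph r l) k (list_order r l k).
Proof.
move=> l_gt1 le_lr k_gt0; have l_gt0 := ltnW l_gt1.
have s_gt0 : (0 < 'C(r, l))%N by rewrite bin_gt0.
set n := list_order r l k; pose x := sparsity r l k.
have x_gt0 : (0 < x)%N by apply: sparsity_gt0.
have le_b : ('C(n, l) <= ('C(n, l) %/ x).+1 * x)%N by rewrite ltnW // ltn_ceil.
have [F [F_size F_large F_blocks]] :=
  clique_free_cocontainers l_gt0 le_lr x_gt0 (erefl : n = _) le_b.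
have F_size' : (size F <= 2 ^ container_bits r l k)%N.
  apply: (leq_trans F_size); rewrite /container_bits [leqRHS]expnM.
  have := list_order_bin_lt l_gt1 le_lr k_gt0; rewrite -/n => lt2.
  by case: (_ * container_loss _)%N => [//|e]; rewrite leq_exp2r.
have room := union_bound_room l_gt1 le_lr k_gt0.
rewrite -/n -[X in (_ <= X)%N](card_edge n l) in room.
rewrite -(card_edge n l) in F_large.
have [L [Lk L_defeats]] := lists_defeating_family s_gt0 k_gt0 F_large F_size' room.
exists (fun e => if insub e is Some v then colours_of (L v) else fset0).
split=> [e|c c_col].
  rewrite inE => el; rewrite (insubT (fun e : {set 'I_n} => #|e| == l) el).
  by rewrite card_colours_of Lk.
pose class i : {set edge n l} := [set v | c (val v) == i].
have [[U [i Ur Ui]]|no_copy] := pselect (exists U : {set 'I_n}, exists2 i : nat,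
    #|U| = r & clique l U \subset class i).
  apply: (monochromatic_copy_of_set Ur (a := i)) => e eU /eqP el.
  have := subsetP Ui (Sub e el); rewrite !inE /= => /(_ eU)/eqP //.
have /fin_all_exists2[D DF dD] (i : 'I_(8 * 'C(r, l) * k)) :
    exists2 D, D \in F & [disjoint D & class i].
  apply: F_blocks => U Ur; apply/negP => Ui; apply: no_copy.
  by exists U, (val i).
have [v Lv] := L_defeats D DF.
have := c_col (val v); rewrite inE valK => /(_ (valP v))/colours_ofP[i iL ci].
have := subsetP Lv i iL; rewrite inE => vD.
by have := disjointFr (dD i) vD; rewrite inE ci eqxx.
Qed.

(** For l = 1 the same list of k colours on every vertex works: one of the k
    colour classes has at least r vertices. *)
Lemma list_ramsey_property_pigeonhole r k :
  list_ramsey_property (complete_uhypergraph r 1) k (k * r.-1).+1.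
Proof.
exists (fun=> colours_of [set: 'I_k]); split=> [e _|c c_col].
  by rewrite card_colours_of cardsT card_ord.
set n := (k * r.-1).+1 in c c_col *.
have [/existsP[a ra]|small] := boolP
    [exists a : 'I_k, r <= #|[set v : 'I_n | c [set v] == a]|]%N.
  have [U Ua Ur] := exists_subset_card ra.
  apply: (monochromatic_copy_of_set Ur (a := a)) => e eU /eqP/cards1P[v ev].
  by have := subsetP Ua v; rewrite inE ev => /(_ _)/eqP ->; rewrite // -sub1set -ev.
exfalso; have : (n <= \sum_(a < k) #|[set v : 'I_n | c [set v] == a]|)%N.
  rewrite -{1}(card_ord n) -cardsT.
  have cover : [set: 'I_n] \subset \bigcup_(a < k) [set v : 'I_n | c [set v] == a].
    apply/subsetP => v _; apply/bigcupP.
    have := c_col [set v]; rewrite inE cards1 eqxx => /(_ isT)/colours_ofP[a _ ca].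
    by exists a => //; rewrite inE ca.
  exact: leq_trans (subset_leq_card cover) (leq_card_bigcup _ _).
apply/negP; rewrite -ltnNge /n ltnS -[k in (_ <= k * _)%N]card_ord -sum_nat_const.
apply: leq_sum => a _; move/existsPn/(_ a): small.
by rewrite -ltnNge; move: #|_| => q; lia.
Qed.

Lemma pigeonhole_number_le r k : (0 < r)%N -> (0 < k)%N ->
  ((k * r.-1).+1 <= 2 ^ (4 * r ^ (3 * 1 - 1)) * r ^ (4 * k * r ^ (1 - 1)))%N.
Proof.
case: r => [//|[|r]] _ k0; first by rewrite muln0 muln_gt0 !expn_gt0.
rewrite expn0 muln1 -[leqLHS]mul1n leq_mul ?expn_gt0 //.
apply: (@leq_trans (r.+2 ^ k * r.+2 ^ k)).
  have kr : (k <= r.+2 ^ k)%N by apply: ltnW (ltn_expl _ _).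
  have rr : (r.+2 <= r.+2 ^ k)%N by rewrite -{1}[r.+2]expn1 leq_exp2l.
  by apply: leq_trans (leq_mul kr rr); rewrite /= mulnS; lia.
by rewrite -expnD leq_exp2l //; lia.
Qed.

Local Open Scope ring_scope.

Lemma powR2_log2 (R : realType) (r a c : nat) : (0 < r)%N ->
  (2 : R) `^ (a%:R + c%:R * log2 r%:R) = (2 ^ a * r ^ c)%:R.
Proof.
move=> r0; have ln2 : ln (2 : R) != 0 by rewrite gt_eqF // ln_gt0 // ltr1n.
rewrite powRD; last by rewrite pnatr_eq0 implybT.
rewrite natrM !natrX -!powR_mulrn ?ler0n //; congr (_ * _).
rewrite /powR /log2 !pnatr_eq0 (gtn_eqF r0) /=.
by rewrite -mulrA divfK.
Qed.

Theorem theorem4 (R : realType) (r l k : nat)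
    (hl : (0 < l)%N) (hlr : (l <= r)%N) (hk : (0 < k)%N) :
  exists N : nat,
    is_list_ramsey_number (complete_uhypergraph r l) k N /\
    (N%:R : R) <=
      2 `^ (4 * r%:R ^+ (3 * l - 1)%N
            + 4 * k%:R * r%:R ^+ (l - 1)%N * log2 r%:R).
Proof.
have r0 : (0 < r)%N by apply: leq_trans hlr.
have [n [n_ramsey n_le]] : exists n,
    list_ramsey_property (complete_uhypergraph r l) k n /\
    (n <= 2 ^ (4 * r ^ (3 * l - 1)) * r ^ (4 * k * r ^ (l - 1)))%N.
  have [l1|l_gt1] := leqP l 1.
    have -> : l = 1%N by lia.
    exists (k * r.-1).+1.
    by split; [exact: list_ramsey_property_pigeonhole|exact: pigeonhole_number_le].
  exists (list_order r l k).
  by split; [exact: list_ramsey_property_list_order|exact: list_order_le].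
pose P m := `[< list_ramsey_property (complete_uhypergraph r l) k m >].
have exP : exists m, P m by exists n; apply/asboolP.
case: (ex_minnP exP) => N /asboolP N_ramsey N_min; exists N; split.
  by split=> // m m_ramsey; apply: N_min; apply/asboolP.
have Nn : (N <= n)%N by apply: N_min; apply/asboolP.
rewrite (_ : 4 * r%:R ^+ _ = (4 * r ^ (3 * l - 1))%:R); last by rewrite natrM natrX.
rewrite (_ : 4 * k%:R * r%:R ^+ _ = (4 * k * r ^ (l - 1))%:R); last by rewrite !natrM natrX.
by rewrite powR2_log2 // ler_nat (leq_trans Nn).
Qed.
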